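(* Let $\mathfrak{B}$ be a bornology with a closed base $\mathfrak{B}_0$ on a topological space $X$, and let $X$ be a $\mathfrak{B}$-Lindelöf space. If $|\mathfrak{B}_0|<\mathfrak{r}$, then $X$ satisfies $\mathrm{Split}(\mathcal{O}_{\mathfrak{B}},\mathcal{O}_{\mathfrak{B}})$.
   Context: A bornology $\mathfrak{B}$ on $X$ is a family of subsets of $X$ that is closed under taking subsets and finite unions and covers $X$; by standing convention $X\notin\mathfrak{B}$. A base of $\mathfrak{B}$ is a subfamily $\mathfrak{B}_0\subseteq\mathfrak{B}$ such that every $B\in\mathfrak{B}$ is contained in some $B_0\in\mathfrak{B}_0$; it is closed if its members are closed subsets of $X$. $\mathcal{O}_{\mathfrak{B}}$ is the collection of all open $\mathfrak{B}$-covers of $X$: families $\mathcal{U}$ of open subsets of $X$ with $X\notin\mathcal{U}$ such that every $B\in\mathfrak{B}$ is contained in some $U\in\mathcal{U}$. $X$ is $\mathfrak{B}$-Lindelöf if every open $\mathfrak{B}$-cover of $X$ contains a countable subfamily that is a $\mathfrak{B}$-cover of $X$. $\mathrm{Split}(\mathcal{A},\mathcal{B})$ means that for each $\mathcal{U}\in\mathcal{A}$ there are $\mathcal{V}_1,\mathcal{V}_2\in\mathcal{B}$ with $\mathcal{V}_1,\mathcal{V}_2\subseteq\mathcal{U}$ and $\mathcal{V}_1\cap\mathcal{V}_2=\emptyset$. Let $[\omega]^\omega$ be the collection of all infinite subsets of $\omega$. A set $R\in[\omega]^\omega$ reaps a family $\mathcal{A}\subseteq[\omega]^\omega$ if for each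 $P\in\mathcal{A}$ both $P\cap R$ and $P\setminus R$ are infinite. $\mathfrak{r}$ is the minimum cardinality of a family $\mathcal{A}\subseteq[\omega]^\omega$ that no infinite subset of $\omega$ reaps. *)

(* Defs.v *)
From mathcomp Require Import all_boot all_order.
From mathcomp Require Import all_classical all_analysis.

Set Implicit Arguments.
Unset Strict Implicit.
Unset Printing Implicit Defensive.

Local Open Scope classical_set_scope.
Local Open Scope card_scope.

Definition bornology (X : Type) (B : set (set X)) : Prop :=
  [/\ forall A C : set X, B C -> A `<=` C -> B A,
      forall A C : set X, B A -> B C -> B (A `|` C),
      \bigcup_(A in B) A = setT
    & ~ B setT].

Definition bornology_base (X : Type) (B B0 : set (set X)) : Prop :=
  B0 `<=` B /\ forall A, B A -> exists2 A0, B0 A0 & A `<=` A0.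

Definition closed_base (X : topologicalType) (B B0 : set (set X)) : Prop :=
  bornology_base B B0 /\ B0 `<=` closed.

Definition open_bcovers (X : topologicalType) (B : set (set X)) :
    set (set (set X)) :=
  [set U | [/\ U `<=` open, ~ U setT
             & forall A, B A -> exists2 O, U O & A `<=` O]].

Definition bLindelof (X : topologicalType) (B : set (set X)) : Prop :=
  forall U, open_bcovers B U ->
    exists V, [/\ V `<=` U, countable V & open_bcovers B V].

Definition split_property (X : Type) (P Q : set (set (set X))) : Prop :=
  forall U, P U -> exists V1 V2 : set (set X),
    [/\ Q V1, Q V2, V1 `<=` U, V2 `<=` U & V1 `&` V2 = set0].

Definition card_lt (T T' : Type) (A : set T) (A' : set T') : Prop :=
  (A #<= A') /\ ~ (A' #<= A).

Definition min_card (T : Type) (P : set (set T)) (A : set T) : Prop :=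
  P A /\ forall A', P A' -> A #<= A'.

Lemma ex_min_card (T : Type) (P : set (set T)) :
  P !=set0 -> exists A, min_card P A.
Proof.
(* Take a maximal set F of choice functions on P that take pairwise distinct
   values at each member of P; by maximality the values of F exhaust some A. *)
move=> [A0 PA0].
pose good (F : set (set T -> T)) :=
  (forall c A, F c -> P A -> A (c A)) /\
  (forall c d A, F c -> F d -> P A -> c A = d A -> c = d).
have [|F [[Fin Finj] Fmax]] := @Zorn_bigcup _ good.
  move=> G Ggood Gtot; split=> [c A [F GF Fc] | c d A [F GF Fc] [F' GF' F'd]].
    exact: (Ggood _ GF).1.
  have [FF'|F'F] := Gtot _ _ GF GF'.
    by apply: (Ggood _ GF').2 => //; exact: FF'.
  by apply: (Ggood _ GF).2 => //; exact: F'F.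
have [[A [PA AF]]|noA] :=
  pselect (exists A, P A /\ A `<=` [set c A | c in F]); last first.
  have new A : exists x, P A -> A x /\ ~ [set c A | c in F] x.
    have [PA|nPA] := pselect (P A).
      have /existsNP[x /not_implyP[Ax Fx]] : ~ (A `<=` [set c A | c in F]).
        by move=> AF; apply: noA; exists A.
      by exists x.
    have [|noT] := pselect (exists x : T, True).
      by move=> [x _]; exists x.
    case: noA; exists A0; split => // x _.
    by case: noT; exists x.
  have [e eP] := choice new.
  have Fe c A : F c -> P A -> c A <> e A.
    by move=> Fc PA ceq; have [_] := eP _ PA; apply; exists c.
  exfalso; apply: (Fmax (F `|` [set e]) _ _).
    split; first by move=> c; left.
    move=> /(_ e (or_intror erefl)) Fee.
    exact: (Fe e A0 Fee PA0).
  split=> [c A [Fc|->] PA | c d A [Fc|->] [Fd|->] PA] //.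
  - exact: Fin Fc PA.
  - exact: (eP _ PA).1.
  - exact: Finj Fc Fd PA.
  - by move/(Fe _ _ Fc PA).
  - by move/esym/(Fe _ _ Fd PA).
exists A; split => // A' PA'.
apply: (card_le_trans (subset_card_le AF)).
apply: (card_le_trans (card_image_le _ _)).
have Finj' : {in F &, injective (fun c : set T -> T => c A')}.
  by move=> c d /set_mem Fc /set_mem Fd; exact: Finj Fc Fd PA'.
rewrite -(card_le_eql (inj_card_eq Finj')).
by apply: subset_card_le => _ [c Fc <-]; exact: Fin Fc PA'.
Qed.

Definition reaps (R : set nat) (F : set (set nat)) : Prop :=
  forall P, F P -> infinite_set (P `&` R) /\ infinite_set (P `\` R).

Definition unreapable (F : set (set nat)) : Prop :=
  F `<=` [set P | infinite_set P] /\
  ~ exists R, infinite_set R /\ reaps R F.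

Lemma unreapable_nonempty : unreapable !=set0.
Proof.
exists [set P | infinite_set P]; split=> // -[R [infR /(_ R infR)[_]]].
by rewrite setDv; apply; exact: finite_set0.
Qed.

(* The cardinal r, represented by a set of that cardinality. *)
Definition reaping_number : set (set nat) :=
  projT1 (cid (ex_min_card unreapable_nonempty)).

Lemma reaping_numberP : min_card unreapable reaping_number.
Proof. exact: projT2 (cid (ex_min_card unreapable_nonempty)). Qed.

(* Main.v *)
Require Import Defs.
From mathcomp Require Import all_boot all_order.
From mathcomp Require Import all_classical all_analysis.

(** Split a countable subcover [V] in two.  Every member of a bornology lies
    inside infinitely many members of an open bornological cover
    ([infinite_above]): given finitely many of them, none of which is the whole
    space, add to the bounded set one point outside each; the result is still
    bounded, hence covered by yet another member.  Numbering [V] injectively, a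
    base set [A] thus yields an infinite set of naturals, the numbers of the
    members of [V] that contain [A].  There are fewer than the reaping number of
    these sets, so a single set [R] of naturals reaps all of them
    ([reaps_of_card_lt]).  The members of [V] with number in [R] and those with
    number outside [R] are then two disjoint subfamilies, and above each base
    set there is a member of each; as the base is cofinal in the bornology, both
    are covers. *)

Local Open Scope classical_set_scope.
Local Open Scope card_scope.

Lemma reaps_of_card_lt (T : Type) (D : set T) (F : set (set nat)) :
  card_lt D reaping_number -> F #<= D -> F `<=` [set P | infinite_set P] ->
  exists R, reaps R F.
Proof.
move=> [_ nle] FD Finf; apply: contrapT => noR; apply: nle.
apply: card_le_trans FD; apply: reaping_numberP.2.
by split=> // -[R [_ RF]]; apply: noR; exists R.
Qed.

(** The bornology may be empty (on the empty space), so that the bounded set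
    escaping the finite family is obtained by enlarging a given one. *)
Lemma bornology_escape {X : Type} {B : set (set X)} {A : set X}
    (s : seq (set X)) :
  bornology B -> B A -> (forall O, O \in s -> O <> setT) ->
  exists C, [/\ B C, A `<=` C & forall O, O \in s -> ~ (C `<=` O)].
Proof.
move=> [Bsub BU Bcov _] BA; elim: s => [_|O s IHs sT].
  by exists A; split=> // x.
have [|C [BC AC Cs]] := IHs; first by move=> P Ps; apply: sT; rewrite inE Ps orbT.
have /existsNP[x Ox] : ~ (forall x, O x).
  by move=> OT; apply: (sT O (mem_head _ _)); apply/seteqP; split.
have [D BD Dx] : (\bigcup_(D in B) D) x by rewrite Bcov.
exists (C `|` D); split; [exact: BU | by move=> y /AC; left |].
move=> P; rewrite inE => /orP[/eqP -> /(_ x (or_intror Dx)) //|Ps CDP].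
by apply: (Cs _ Ps) => y Cy; apply: CDP; left.
Qed.

Lemma infinite_above {X : topologicalType} {B V : set (set X)} {A : set X} :
  bornology B -> open_bcovers B V -> B A ->
  infinite_set (V `&` [set O | A `<=` O]).
Proof.
move=> bB [_ VT Vcov] BA /finite_seqP[s sE].
have [|C [BC AC Cs]] := bornology_escape s bB BA.
  move=> P Ps; have : [set` s] P by [].
  by rewrite -sE => -[VP _] PT; apply: VT; rewrite -PT.
have [ O VO CO] := Vcov _ BC.
apply: (Cs O) => //; suff : [set` s] O by [].
by rewrite -sE; split=> // x /AC /CO.
Qed.

Lemma open_bcovers_sub {X : topologicalType} {B B0 V W : set (set X)} :
  bornology_base B B0 -> open_bcovers B V -> W `<=` V ->
  (forall A, B0 A -> exists2 O, W O & A `<=` O) -> open_bcovers B W.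
Proof.
move=> [_ Bbase] [Vop VT _] WV Wcov; split=> [ O /WV /Vop //|/WV //|A BA].
have [A0 B0A0 AA0] := Bbase _ BA; have [ O WO A0O] := Wcov _ B0A0.
by exists O => // x /AA0 /A0O.
Qed.

Theorem proposition4p16 (X : topologicalType) (B B0 : set (set X)) :
  bornology B -> closed_base B B0 -> bLindelof B ->
  card_lt B0 reaping_number ->
  split_property (open_bcovers B) (open_bcovers B).
Proof.
move=> bB [base _] lind ltB0 U Ucov.
have [V [VU /countable_injP[f finj] Vcov]] := lind U Ucov.
pose tr A := f @` (V `&` [set O | A `<=` O]).
have tr_inf : tr @` B0 `<=` [set P | infinite_set P].
  move=> _ [A B0A <-] trfin; apply: (infinite_above bB Vcov (base.1 _ B0A)).
  have finjA : {in V `&` [set O | A `<=` O] &, injective f}.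
    by move=> O O' /set_mem[VO _] /set_mem[VO' _]; apply: finj; exact: mem_set.
  by rewrite -(eq_finite_set (inj_card_eq finjA)).
have [R RP] := reaps_of_card_lt _ _ _ ltB0 (card_image_le tr B0) tr_inf.
exists (V `&` f @^-1` R), (V `\` f @^-1` R); split.
- apply: (open_bcovers_sub base Vcov) => [ O []//|A B0A].
  have [/infinite_setN0[_ [[ O [VO AO] <-] RO]] _] := RP _ (imageP tr B0A).
  by exists O.
- apply: (open_bcovers_sub base Vcov) => [ O []//|A B0A].
  have [_ /infinite_setN0[_ [[ O [VO AO] <-] RO]]] := RP _ (imageP tr B0A).
  by exists O.
- by move=> O [/VU].
- by move=> O [/VU].
- by rewrite -subset0 => O [[_ RO] [_ /(_ RO)]].
Qed.
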